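(* $$\frac{44\sqrt[3]{2}}{9}=\sum_{j=0}^{\infty}\left(-\frac14\right)^{j}\frac{\left(\frac23\right)_j\left(\frac34\right)_j\left(\frac54\right)_j}{\left(\frac5{12}\right)_j(1)_j\left(\frac{23}{12}\right)_j}\,(10j+9).$$
   Context: $(x)_0=1$ and $(x)_j=x(x+1)\cdots(x+j-1)$ for positive integers $j$ (rising factorial). *)

(* Defs.v *)
From Stdlib Require Import Reals.
Open Scope R_scope.

Fixpoint rising_factorial (x : R) (j : nat) : R :=
  match j with
  | O => 1
  | S i => rising_factorial x i * (x + INR i)
  end.

(* Main.v *)
Require Import Defs.
From Stdlib Require Import Reals Lra Lia.
From Coquelicot Require Import Coquelicot.
Open Scope R_scope.

(** The series is a Beta integral in disguise, and a cubic substitution evaluates it.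

    Put w(s) = (1 - s^2)^(-2/3) and l = int_0^1 w.  Integration by parts gives the moments
    int_0^1 s^(2n) w(s) ds = l (1/2)_n / (5/6)_n ([moment_limit]).  Expanding
    (1 + s^4/4)^(-2/3) in powers of s^4 and integrating termwise therefore turns
      J = int_0^1 (6 - s^2) w(s) (1 + s^4/4)^(-2/3) ds
    into l times the series with terms t_j (20 j + 9) / (4 j + 5/3), where
      t_j = (-1/4)^j (2/3)_j / j! * (1/2)_(2j) / (5/6)_(2j).
    The factor 20 j + 9 comes from the polynomial 6 - s^2.

    On the other hand y = (3 s^3 + s^2 - 2) / (s^3 - s^2 + 2) maps (0,1) increasingly onto
    (-1,1) and satisfies
      4^(2/3) w(y) dy = (6 - s^2) w(s) (1 + s^4/4)^(-2/3) ds     ([weight_cubic_map]),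
    so J = 4^(2/3) int_(-1)^1 w = 2 * 4^(2/3) l ([twisted_limit]).  Dividing by l > 0, the
    series above has sum 2 * 4^(2/3) = 4 * 2^(1/3) ([ratio_sum_error]).

    Finally the terms of the series to be summed are 11/9 times these terms plus the
    difference of successive values of -(88/3) j t_j, which tends to 0
    ([summand_telescopes]); hence the value 11/9 * 4 * 2^(1/3).

    Since w is singular at 1 and at -1, every integral is taken as a primitive from 0 to c < 1,
    and c tends to 1 at the end. *)

(** * Comparison of derivatives and primitives *)

(** Integrating an inequality between derivatives, without integrals.  The mean value theorem
    is applied to g - e f with e = 1 and e = -1. *)
Lemma derivative_dominates (f f' g g' : R -> R) (a b : R) :
  a <= b ->
  (forall x, a <= x <= b -> is_derive f x (f' x)) ->
  (forall x, a <= x <= b -> is_derive g x (g' x)) ->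
  (forall x, a <= x <= b -> Rabs (f' x) <= g' x) ->
  Rabs (f b - f a) <= g b - g a.
Proof.
intros Hab Hf Hg Hfg.
assert (key : forall e, Rabs e <= 1 -> 0 <= (g b - e * f b) - (g a - e * f a)).
{ intros e He.
  assert (Hd : forall x, a <= x <= b ->
    is_derive (fun x => g x - e * f x) x (g' x - e * f' x)).
  { intros x Hx.
    apply (is_derive_minus (V := R_NormedModule) g (fun x => e * f x)).
    - now apply Hg.
    - apply is_derive_scal. now apply Hf. }
  destruct (MVT_gen (fun x => g x - e * f x) a b (fun x => g' x - e * f' x))
    as [x [Hx Heq]].
  - rewrite Rmin_left, Rmax_right by lra. intros x Hx. apply Hd; lra.
  - rewrite Rmin_left, Rmax_right by lra. intros x Hx.
    apply continuity_pt_filterlim.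
    apply (ex_derive_continuous (V := R_NormedModule) (fun x => g x - e * f x)).
    exists (g' x - e * f' x). now apply Hd.
  - rewrite Rmin_left, Rmax_right in Hx by lra. rewrite Heq.
    apply Rmult_le_pos; [|lra].
    specialize (Hfg x Hx).
    assert (e * f' x <= Rabs (f' x)).
    { apply Rle_trans with (1 := Rle_abs _). rewrite Rabs_mult.
      pose proof (Rabs_pos (f' x)). nra. }
    lra. }
apply Rabs_le.
assert (H1 := key 1 ltac:(rewrite Rabs_R1; lra)).
assert (H2 := key (-1) ltac:(rewrite Rabs_left; lra)).
lra.
Qed.

Lemma derivative_zero_constant (f : R -> R) (a b : R) :
  a <= b -> (forall x, a <= x <= b -> is_derive f x 0) -> f b = f a.
Proof.
intros Hab Hf.
assert (H : Rabs (f b - f a) <= 0 - 0).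
{ apply (derivative_dominates f (fun _ => 0) (fun _ => 0) (fun _ => 0)); auto.
  - intros x _. apply (is_derive_const (V := R_NormedModule)).
  - intros x _. rewrite Rabs_R0. lra. }
pose proof (Rabs_pos (f b - f a)).
assert (f b - f a = 0) by (apply Rabs_eq_0; lra). lra.
Qed.

Lemma is_derive_Rpower (a x : R) :
  0 < x -> is_derive (fun t => Rpower t a) x (a * Rpower x (a - 1)).
Proof. intros Hx. apply is_derive_Reals. now apply derivable_pt_lim_power. Qed.

Definition primitive (f : R -> R) (c : R) : R := RInt f 0 c.

Lemma is_derive_primitive (f : R -> R) (c : R) :
  (forall x, -1 < x < 1 -> ex_derive f x) -> -1 < c < 1 ->
  is_derive (primitive f) c (f c).
Proof.
intros Hf Hc.
assert (Hcont : forall x, -1 < x < 1 -> continuous f x).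
{ intros x Hx. apply (ex_derive_continuous (V := R_NormedModule)). now apply Hf. }
apply (is_derive_RInt (V := R_NormedModule)) with (a := 0).
- apply (locally_interval _ c (-1) 1); simpl; try lra.
  intros x H1 H2.
  apply (RInt_correct (V := R_CompleteNormedModule)).
  apply (ex_RInt_continuous (V := R_CompleteNormedModule)).
  intros z Hz. apply Hcont.
  unfold Rmin, Rmax in Hz. destruct (Rle_dec 0 x); lra.
- now apply Hcont.
Qed.

(** * The weight and its moments *)

Definition weight (s : R) : R := Rpower (1 - s ^ 2) (- (2 / 3)).

Lemma ex_derive_weight (s : R) : -1 < s < 1 -> ex_derive weight s.
Proof. intros Hs. unfold weight, Rpower. auto_derive. nra. Qed.

Lemma weight_pos (s : R) : 0 < weight s.
Proof. apply exp_pos. Qed.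

Definition moment (n : nat) : R -> R :=
  primitive (fun s => s ^ (2 * n) * weight s).

Lemma moment_at_0 (n : nat) : moment n 0 = 0.
Proof. apply (RInt_point (V := R_CompleteNormedModule)). Qed.

Lemma is_derive_moment (n : nat) (c : R) : -1 < c < 1 ->
  is_derive (moment n) c (c ^ (2 * n) * weight c).
Proof.
intros Hc. apply (is_derive_primitive (fun s => s ^ (2 * n) * weight s)); [|exact Hc].
intros x Hx. apply (ex_derive_mult (fun s => s ^ (2 * n)) weight).
- apply ex_derive_pow. apply ex_derive_id.
- now apply ex_derive_weight.
Qed.

Lemma is_derive_moment_0 (c : R) : -1 < c < 1 ->
  is_derive (moment 0) c (weight c).
Proof.
intros Hc. replace (weight c) with (c ^ (2 * 0) * weight c) by (simpl; ring).
now apply is_derive_moment.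
Qed.

Lemma moment_0_odd (c : R) : -1 < c < 1 -> moment 0 (- c) = - moment 0 c.
Proof.
assert (pos : forall c, 0 <= c < 1 -> moment 0 (- c) = - moment 0 c).
{ clear c. intros c Hc.
  assert (H := derivative_zero_constant (fun s => moment 0 s + moment 0 (- s)) 0 c
    (proj1 Hc)).
  simpl in H. rewrite Ropp_0, moment_at_0 in H.
  enough (moment 0 c + moment 0 (- c) = 0 + 0) by lra.
  apply H. intros x Hx.
  replace 0 with (plus (weight x) (scal (-1) (weight (- x)))).
  - apply (is_derive_plus (V := R_NormedModule)).
    + apply is_derive_moment_0; lra.
    + apply (is_derive_comp (V := R_NormedModule) (moment 0) Ropp).
      * apply is_derive_moment_0; lra.
      * auto_derive; [exact I | ring].
  - unfold plus, scal; simpl. unfold mult; simpl.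
    unfold weight. replace ((- x) ^ 2) with (x ^ 2) by ring. simpl. ring. }
intros Hc. destruct (Rle_dec 0 c) as [H|H]; [apply pos; lra|].
specialize (pos (- c)). rewrite Ropp_involutive in pos. lra.
Qed.

(** Since 1 - s^2 >= 1 - s, the weight is at most (1 - s)^(-2/3), whose primitive
    -3 (1 - s)^(1/3) stays bounded. *)
Lemma moment_0_bound (c : R) : 0 <= c < 1 -> moment 0 c <= 3.
Proof.
intros Hc.
assert (H := derivative_dominates (moment 0) weight
  (fun s => - 3 * Rpower (1 - s) (1 / 3)) (fun s => Rpower (1 - s) (- (2 / 3))) 0 c).
assert (H0 : Rabs (moment 0 c - moment 0 0) <=
  - 3 * Rpower (1 - c) (1 / 3) - (- 3 * Rpower (1 - 0) (1 / 3))).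
{ apply H; try lra.
  - intros x Hx. apply is_derive_moment_0; lra.
  - intros x Hx.
    replace (Rpower (1 - x) (- (2 / 3)))
      with (- 3 * (scal (-1) (1 / 3 * Rpower (1 - x) (1 / 3 - 1)))).
    + apply (is_derive_scal (fun s => Rpower (1 - s) (1 / 3))).
      apply (is_derive_comp (V := R_NormedModule) (fun t => Rpower t (1 / 3)) (fun s => 1 - s)).
      * apply is_derive_Rpower. lra.
      * auto_derive; [exact I | ring].
    + unfold scal; simpl; unfold mult; simpl.
      replace (1 / 3 - 1) with (- (2 / 3)) by field. field.
  - intros x Hx. rewrite Rabs_pos_eq by (left; apply weight_pos).
    unfold weight. rewrite !Rpower_Ropp.
    apply Rinv_le_contravar; [apply exp_pos|].
    apply Rle_Rpower_l; nra. }
rewrite moment_at_0, Rminus_0_r in H0.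
assert (Rpower (1 - 0) (1 / 3) = 1).
{ rewrite Rminus_0_r. unfold Rpower. rewrite ln_1, Rmult_0_r. apply exp_0. }
pose proof (Rle_abs (moment 0 c)).
assert (0 < Rpower (1 - c) (1 / 3)) by apply exp_pos.
lra.
Qed.

Lemma moment_0_increasing (a b : R) : 0 <= a <= b -> b < 1 -> moment 0 a <= moment 0 b.
Proof.
intros Hab Hb.
assert (H := derivative_dominates (fun _ => 0) (fun _ => 0) (moment 0) weight a b
  ltac:(lra)).
enough (Rabs (0 - 0) <= moment 0 b - moment 0 a) by (pose proof (Rabs_pos (0 - 0)); lra).
apply H.
- intros x _. apply (is_derive_const (V := R_NormedModule)).
- intros x Hx. apply is_derive_moment_0; lra.
- intros x _. rewrite Rabs_R0. left. apply weight_pos.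
Qed.

Lemma moment_0_pos : 0 < moment 0 (1 / 2).
Proof.
assert (H : Rabs (1 / 2 - 0) <= moment 0 (1 / 2) - moment 0 0).
{ apply (derivative_dominates (fun s => s) (fun _ => 1) (moment 0) weight); try lra.
  - intros x _. apply (is_derive_id (K := R_AbsRing)).
  - intros x Hx. apply is_derive_moment_0; lra.
  - intros x Hx. rewrite Rabs_R1. unfold weight. rewrite Rpower_Ropp.
    rewrite <- Rinv_1. apply Rinv_le_contravar; [apply exp_pos|].
    apply Rle_trans with (Rpower 1 (2 / 3)).
    + apply Rle_Rpower_l; [lra | nra].
    + unfold Rpower. rewrite ln_1, Rmult_0_r, exp_0. lra. }
rewrite moment_at_0 in H.
pose proof (Rle_abs (1 / 2 - 0)). lra.
Qed.

(** The limit l is the total mass of the weight on (0,1).  Being nonzero, it cancels between the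
    two evaluations of J. *)
Lemma moment_0_limit :
  exists l, 0 < l /\ filterlim (moment 0) (at_left 1) (locally l).
Proof.
destruct (completeness (fun v => exists c, 0 <= c < 1 /\ v = moment 0 c)) as [l [Hub Hlub]].
- exists 3. intros v [c [Hc ->]]. now apply moment_0_bound.
- exists (moment 0 0), 0. split; [lra | reflexivity].
- exists l. split.
  + apply Rlt_le_trans with (1 := moment_0_pos). apply Hub. exists (1 / 2). split; [lra | reflexivity].
  + apply filterlim_locally. intros eps.
    assert (Ha : exists a, 0 <= a < 1 /\ l - eps < moment 0 a).
    { destruct (Classical_Prop.classic (exists a, 0 <= a < 1 /\ l - eps < moment 0 a))
        as [H|H]; [exact H|].
      exfalso. assert (l <= l - eps).
      { apply Hlub. intros v [c [Hc ->]]. apply Rnot_lt_le. intros Hlt.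
        apply H. now exists c. }
      pose proof (cond_pos eps). lra. }
    destruct Ha as [a [Ha Hal]].
    apply (locally_interval _ 1 a p_infty); simpl; try lra; try exact I.
    intros x Hx _ Hx1.
    assert (moment 0 a <= moment 0 x) by (apply moment_0_increasing; lra).
    assert (moment 0 x <= l). { apply Hub. exists x. split; [lra | reflexivity]. }
    pose proof (cond_pos eps). apply Rabs_def1; unfold minus, plus, opp; simpl; lra.
Qed.

Lemma filterlim_linear {T : Type} (F : (T -> Prop) -> Prop) {FF : Filter F}
    (f g : T -> R) (l m a b : R) :
  filterlim f F (locally l) -> filterlim g F (locally m) ->
  filterlim (fun x => a * f x + b * g x) F (locally (a * l + b * m)).
Proof.
intros Hf Hg.
apply (filterlim_comp_2 (G := locally (a * l)) (H := locally (b * m))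
  (fun x => a * f x) (fun x => b * g x) Rplus).
- apply (filterlim_comp _ _ _ f (fun y => a * y) F (locally l)); [exact Hf|].
  apply (filterlim_scal_r (V := R_NormedModule) a l).
- apply (filterlim_comp _ _ _ g (fun y => b * y) F (locally m)); [exact Hg|].
  apply (filterlim_scal_r (V := R_NormedModule) b m).
- apply (filterlim_plus (V := R_NormedModule)).
Qed.

(** Integration by parts: s^(2n+1) (1 - s^2)^(1/3) has derivative
    w(s) ((2n + 1) s^(2n) - (2n + 5/3) s^(2n+2)). *)
Lemma moment_recurrence (n : nat) (c : R) : 0 <= c < 1 ->
  (2 * INR n + 5 / 3) * moment (S n) c
  = (2 * INR n + 1) * moment n c - c ^ (2 * n + 1) * Rpower (1 - c ^ 2) (1 / 3).
Proof.
intros Hc.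
set (f := fun s => (2 * INR n + 1) * moment n s - (2 * INR n + 5 / 3) * moment (S n) s
  - s ^ (2 * n + 1) * Rpower (1 - s ^ 2) (1 / 3)).
assert (H : f c = f 0).
{ apply derivative_zero_constant; [lra|].
  - intros x Hx.
    assert (Hb : is_derive (fun s => s ^ (2 * n + 1) * Rpower (1 - s ^ 2) (1 / 3)) x
      (((2 * INR n + 1) * x ^ (2 * n)) * Rpower (1 - x ^ 2) (1 / 3)
       + x ^ (2 * n + 1) * (- 2 * x * (1 / 3 * Rpower (1 - x ^ 2) (1 / 3 - 1))))).
    { apply (is_derive_mult (K := R_AbsRing) (fun s => s ^ (2 * n + 1))
        (fun s => Rpower (1 - s ^ 2) (1 / 3))).
      - auto_derive; [exact I|].
        replace (Init.Nat.pred (n + (n + 0) + 1)) with (2 * n)%nat by lia.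
        rewrite !plus_INR. simpl INR. ring.
      - apply (is_derive_comp (V := R_NormedModule) (fun t => Rpower t (1 / 3))
          (fun s => 1 - s ^ 2)).
        + apply is_derive_Rpower. nra.
        + auto_derive; [exact I | ring].
      - intros; apply Rmult_comm. }
    unfold f.
    replace 0 with ((2 * INR n + 1) * (x ^ (2 * n) * weight x)
      - (2 * INR n + 5 / 3) * (x ^ (2 * S n) * weight x)
      - (((2 * INR n + 1) * x ^ (2 * n)) * Rpower (1 - x ^ 2) (1 / 3)
       + x ^ (2 * n + 1) * (- 2 * x * (1 / 3 * Rpower (1 - x ^ 2) (1 / 3 - 1))))).
    + apply (is_derive_minus (V := R_NormedModule)
        (fun s => (2 * INR n + 1) * moment n s - (2 * INR n + 5 / 3) * moment (S n) s)
        (fun s => s ^ (2 * n + 1) * Rpower (1 - s ^ 2) (1 / 3))); [|exact Hb].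
      apply (is_derive_minus (V := R_NormedModule)
        (fun s => (2 * INR n + 1) * moment n s)
        (fun s => (2 * INR n + 5 / 3) * moment (S n) s)).
      * apply is_derive_scal, is_derive_moment; lra.
      * apply is_derive_scal, is_derive_moment; lra.
    + replace (Rpower (1 - x ^ 2) (1 / 3)) with ((1 - x ^ 2) * weight x).
      * replace (Rpower (1 - x ^ 2) (1 / 3 - 1)) with (weight x)
          by (unfold weight; f_equal; field).
        replace (2 * S n)%nat with (2 * n + 1 + 1)%nat by lia.
        rewrite !pow_add. simpl. field.
      * unfold weight. rewrite <- (Rpower_1 (1 - x ^ 2)) at 1 by nra.
        rewrite <- Rpower_plus. f_equal. field. }
assert (f 0 = 0).
{ unfold f. rewrite !moment_at_0. rewrite (pow_i (2 * n + 1)) by lia. ring. }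
rewrite H0 in H. unfold f in H. lra.
Qed.

Lemma boundary_term_vanishes :
  filterlim (fun c => Rpower (1 - c ^ 2) (1 / 3)) (at_left 1) (locally 0).
Proof.
apply filterlim_locally. intros eps.
pose proof (cond_pos eps) as He.
set (d := Rmin (eps ^ 3 / 2) 1).
assert (Hd : 0 < d).
{ apply Rmin_glb_lt; [|lra]. assert (0 < eps ^ 3) by now apply pow_lt. lra. }
apply (locally_interval _ 1 (1 - d) p_infty); simpl; try lra; try exact I.
intros x Hx _ Hx1.
assert (d <= eps ^ 3 / 2) by apply Rmin_l.
assert (d <= 1) by apply Rmin_r.
assert (Hlt : Rpower (1 - x ^ 2) (1 / 3) < eps).
{ replace (pos eps) with (Rpower (eps ^ 3) (1 / 3)).
  - apply Rlt_Rpower_l; [lra|]. split; nra.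
  - rewrite <- Rpower_pow by exact He. rewrite Rpower_mult.
    replace (INR 3 * (1 / 3)) with 1 by (simpl; field). now apply Rpower_1. }
assert (0 < Rpower (1 - x ^ 2) (1 / 3)) by apply exp_pos.
change (Rabs (Rpower (1 - x ^ 2) (1 / 3) - 0) < eps).
rewrite Rminus_0_r, Rabs_pos_eq; lra.
Qed.

Lemma rising_factorial_pos (x : R) (j : nat) : 0 < x -> 0 < rising_factorial x j.
Proof.
intros Hx. induction j as [|j IH]; simpl; [lra|].
apply Rmult_lt_0_compat; [exact IH|]. pose proof (pos_INR j). lra.
Qed.

Lemma at_left_eventually (a : R) (P : R -> Prop) : a < 1 ->
  (forall c, a < c < 1 -> P c) -> at_left 1 P.
Proof.
intros Ha HP. apply (locally_interval _ 1 a p_infty); simpl; try lra; try exact I.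
intros x Hx _ Hx1. apply HP. lra.
Qed.

Lemma moment_limit (l : R) (n : nat) :
  filterlim (moment 0) (at_left 1) (locally l) ->
  filterlim (moment n) (at_left 1)
    (locally (l * (rising_factorial (1 / 2) n / rising_factorial (5 / 6) n))).
Proof.
intros Hl. induction n as [|n IH].
- simpl. replace (l * (1 / 1)) with l by field. exact Hl.
- pose proof (pos_INR n).
  set (b := fun c => c ^ (2 * n + 1) * Rpower (1 - c ^ 2) (1 / 3)).
  assert (Hb : filterlim b (at_left 1) (locally 0)).
  { apply (filterlim_le_le (F := at_left 1) (fun _ => 0) b (fun c => Rpower (1 - c ^ 2) (1 / 3)) 0).
    - apply (at_left_eventually 0); [lra|]. intros c Hc. unfold b.
      assert (0 < Rpower (1 - c ^ 2) (1 / 3)) by apply exp_pos.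
      assert (0 <= c ^ (2 * n + 1)) by (apply pow_le; lra).
      assert (c ^ (2 * n + 1) <= 1) by (rewrite <- (pow1 (2 * n + 1)); apply pow_incr; lra).
      nra.
    - apply filterlim_const.
    - exact boundary_term_vanishes. }
  apply (filterlim_ext_loc (fun c => ((2 * INR n + 1) / (2 * INR n + 5 / 3)) * moment n c
    + (- (1 / (2 * INR n + 5 / 3))) * b c)).
  + apply (at_left_eventually 0); [lra|]. intros c Hc. unfold b.
    pose proof (moment_recurrence n c ltac:(lra)) as E.
    apply (Rmult_eq_reg_l (2 * INR n + 5 / 3)); [|lra]. rewrite E. field. lra.
  + replace (l * (rising_factorial (1 / 2) (S n) / rising_factorial (5 / 6) (S n)))
      with (((2 * INR n + 1) / (2 * INR n + 5 / 3))
          * (l * (rising_factorial (1 / 2) n / rising_factorial (5 / 6) n))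
        + (- (1 / (2 * INR n + 5 / 3))) * 0).
    * apply filterlim_linear; [apply within_filter, locally_filter | exact IH | exact Hb].
    * pose proof (rising_factorial_pos (5 / 6) n). simpl. field. lra.
Qed.

(** * Remainder of the binomial series *)

Definition binomial_coefficient (a : R) (j : nat) : R :=
  rising_factorial a j / rising_factorial 1 j.

Lemma binomial_coefficient_S (a : R) (j : nat) :
  INR (S j) * binomial_coefficient a (S j) = (a + INR j) * binomial_coefficient a j.
Proof.
unfold binomial_coefficient. pose proof (rising_factorial_pos 1 j).
pose proof (pos_INR j). rewrite S_INR. simpl. field. lra.
Qed.

Lemma binomial_coefficient_bounds (a : R) (j : nat) : 0 < a <= 1 ->
  0 < binomial_coefficient a j <= 1.
Proof.
intros Ha. induction j as [|j IH].
- unfold binomial_coefficient; simpl. lra.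
- pose proof (binomial_coefficient_S a j) as E. pose proof (pos_INR j).
  rewrite S_INR in E. nra.
Qed.

Definition binomial_sum (a x : R) (N : nat) : R :=
  sum_n (fun j => binomial_coefficient a j * (- x) ^ j) N.

(** The partial sum S_N of the series of (1 + t)^(-a) satisfies (1 + t) S_N' + a S_N = one
    monomial, because all other coefficients cancel.  Hence the ratio of S_N to (1 + t)^(-a)
    has a derivative with a single term. *)
Lemma is_derive_binomial_quotient (a x : R) (N : nat) : 0 <= x ->
  is_derive (fun t => Rpower (1 + t) a * binomial_sum a t N) x
    ((a + INR N) * binomial_coefficient a N * (- x) ^ N * Rpower (1 + x) (a - 1)).
Proof.
intros Hx.
assert (Hp : is_derive (fun t => Rpower (1 + t) a) x (a * Rpower (1 + x) (a - 1))).
{ replace (a * Rpower (1 + x) (a - 1)) with (scal 1 (a * Rpower (1 + x) (a - 1)))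
    by (unfold scal; simpl; unfold mult; simpl; ring).
  apply (is_derive_comp (V := R_NormedModule) (fun t => Rpower t a) (fun t => 1 + t)).
  - apply is_derive_Rpower. lra.
  - auto_derive; [exact I | ring]. }
induction N as [|N IH].
- apply (is_derive_ext (fun t => Rpower (1 + t) a)).
  + intros t. unfold binomial_sum, binomial_coefficient. rewrite sum_O. simpl. field.
  + replace ((a + INR 0) * binomial_coefficient a 0 * (- x) ^ 0 * Rpower (1 + x) (a - 1))
      with (a * Rpower (1 + x) (a - 1)); [exact Hp|].
    unfold binomial_coefficient; simpl; field.
- apply (is_derive_ext (fun t => Rpower (1 + t) a * binomial_sum a t N
    + Rpower (1 + t) a * (binomial_coefficient a (S N) * (- t) ^ S N))).
  + intros t. unfold binomial_sum. rewrite sum_Sn. unfold plus; simpl. ring.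
  + assert (Hm : is_derive (fun t => binomial_coefficient a (S N) * (- t) ^ S N) x
      (- (INR (S N) * binomial_coefficient a (S N)) * (- x) ^ N)).
    { auto_derive; [exact I|]. simpl. ring. }
    replace ((a + INR (S N)) * binomial_coefficient a (S N) * (- x) ^ S N
        * Rpower (1 + x) (a - 1))
      with ((a + INR N) * binomial_coefficient a N * (- x) ^ N * Rpower (1 + x) (a - 1)
        + (a * Rpower (1 + x) (a - 1) * (binomial_coefficient a (S N) * (- x) ^ S N)
           + Rpower (1 + x) a * (- (INR (S N) * binomial_coefficient a (S N)) * (- x) ^ N))).
    * apply (is_derive_plus (V := R_NormedModule)
        (fun t => Rpower (1 + t) a * binomial_sum a t N)
        (fun t => Rpower (1 + t) a * (binomial_coefficient a (S N) * (- t) ^ S N))); [exact IH|].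
      apply (is_derive_mult (K := R_AbsRing) (fun t => Rpower (1 + t) a)
        (fun t => binomial_coefficient a (S N) * (- t) ^ S N)); [exact Hp | exact Hm |].
      intros; apply Rmult_comm.
    * replace (Rpower (1 + x) a) with ((1 + x) * Rpower (1 + x) (a - 1)).
      -- rewrite <- binomial_coefficient_S. rewrite S_INR. simpl. ring.
      -- rewrite <- (Rpower_1 (1 + x)) at 1 by lra. rewrite <- Rpower_plus. f_equal. ring.
Qed.

Lemma INR_le_pow2 (n : nat) : INR n <= 2 ^ n.
Proof.
induction n as [|n IH]; [simpl; lra|]. rewrite S_INR. simpl.
assert (1 <= 2 ^ n) by (apply pow_R1_Rle; lra). lra.
Qed.

Lemma Rpower_le_1 (x e : R) : 1 <= x -> e <= 0 -> Rpower x e <= 1.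
Proof.
intros Hx He. apply Rle_trans with (Rpower x 0).
- now apply Rle_Rpower.
- rewrite Rpower_O; lra.
Qed.

(** The ratio of the partial sum to (1 + x)^(-a) is 1 at 0, and the derivative found in
    [is_derive_binomial_quotient] is at most (N + 1) / 4^N on [0, 1/4]; the factor N + 1 is
    absorbed by weakening 1/4 to 1/2. *)
Lemma binomial_sum_error (a x : R) (N : nat) : 0 < a <= 1 -> 0 <= x <= 1 / 4 ->
  Rabs (binomial_sum a x N - Rpower (1 + x) (- a)) <= (1 / 2) ^ S N.
Proof.
intros Ha Hx.
set (Q := fun t => Rpower (1 + t) a * binomial_sum a t N).
assert (Q0 : Q 0 = 1).
{ unfold Q, binomial_sum. rewrite Rplus_0_r. unfold Rpower at 1. rewrite ln_1, Rmult_0_r, exp_0.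
  rewrite Rmult_1_l. clear. induction N as [|N IH].
  - rewrite sum_O. unfold binomial_coefficient; simpl. field.
  - rewrite sum_Sn, IH. unfold plus; simpl. ring. }
assert (HQ : Rabs (Q x - Q 0) <= INR (S N) * (1 / 4) ^ N * x - INR (S N) * (1 / 4) ^ N * 0).
{ apply (derivative_dominates Q _ (fun t => INR (S N) * (1 / 4) ^ N * t)
    (fun _ => INR (S N) * (1 / 4) ^ N) 0 x (proj1 Hx)
    (fun t Ht => is_derive_binomial_quotient a t N (proj1 Ht))).
  - intros t _. auto_derive; [exact I | simpl; ring].
  - intros t Ht. rewrite <- binomial_coefficient_S.
    rewrite !Rabs_mult, <- RPow_abs, Rabs_Ropp.
    rewrite (Rabs_pos_eq t), (Rabs_pos_eq (INR _)), (Rabs_pos_eq (binomial_coefficient _ _)),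
      (Rabs_pos_eq (Rpower _ _)); try lra; try apply pos_INR;
      try (left; apply exp_pos); try (left; now apply binomial_coefficient_bounds).
    assert (Hr : 0 < Rpower (1 + t) (a - 1) <= 1).
    { split; [apply exp_pos|].
      apply Rpower_le_1; lra. }
    pose proof (binomial_coefficient_bounds a (S N) Ha) as Hc.
    assert (Ht' : 0 <= t ^ N <= (1 / 4) ^ N).
    { split; [apply pow_le; lra | apply pow_incr; lra]. }
    pose proof (pos_INR (S N)) as Hn.
    rewrite <- (Rmult_1_r (INR (S N) * (1 / 4) ^ N)).
    apply Rmult_le_compat; try lra.
    + apply Rmult_le_pos; [apply Rmult_le_pos|]; lra.
    + apply Rmult_le_compat; try lra; [apply Rmult_le_pos; lra | nra]. }
rewrite Q0 in HQ.
assert (HQ' : Rabs (Q x - 1) <= (1 / 2) ^ S N).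
{ apply Rle_trans with (1 := HQ).
  apply Rle_trans with (INR (S N) * (1 / 4) ^ S N).
  - rewrite Rmult_0_r, Rminus_0_r, Rmult_assoc.
    apply Rmult_le_compat_l; [apply pos_INR|].
    rewrite <- tech_pow_Rmult, Rmult_comm.
    apply Rmult_le_compat_r; [apply pow_le; lra | lra].
  - replace ((1 / 2) ^ S N) with (2 ^ S N * (1 / 4) ^ S N)
      by (rewrite <- Rpow_mult_distr; f_equal; field).
    apply Rmult_le_compat_r; [apply pow_le; lra | apply INR_le_pow2]. }
replace (binomial_sum a x N - Rpower (1 + x) (- a)) with (Rpower (1 + x) (- a) * (Q x - 1)).
- rewrite Rabs_mult, (Rabs_pos_eq (Rpower _ _)) by (left; apply exp_pos).
  assert (Rpower (1 + x) (- a) <= 1) by (apply Rpower_le_1; lra).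
  assert (0 < Rpower (1 + x) (- a)) by apply exp_pos.
  pose proof (Rabs_pos (Q x - 1)). nra.
- unfold Q. rewrite Rmult_minus_distr_l, <- Rmult_assoc, <- Rpower_plus.
  rewrite Rplus_opp_l, Rpower_O by lra. ring.
Qed.

(** * The cubic substitution *)

Definition cubic_map (s : R) : R := (3 * s ^ 3 + s ^ 2 - 2) / (s ^ 3 - s ^ 2 + 2).

Lemma cubic_map_denominator_pos (s : R) : 0 <= s <= 1 -> 0 < s ^ 3 - s ^ 2 + 2.
Proof. intros Hs. assert (0 <= s ^ 3) by (apply pow_le; lra). nra. Qed.

Lemma one_plus_cubic_map (s : R) : 0 <= s <= 1 ->
  1 + cubic_map s = 4 * s ^ 3 / (s ^ 3 - s ^ 2 + 2).
Proof.
intros Hs. pose proof (cubic_map_denominator_pos s Hs). unfold cubic_map. field. lra.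
Qed.

Lemma one_minus_cubic_map (s : R) : 0 <= s <= 1 ->
  1 - cubic_map s = 2 * (2 - s ^ 2 - s ^ 3) / (s ^ 3 - s ^ 2 + 2).
Proof.
intros Hs. pose proof (cubic_map_denominator_pos s Hs). unfold cubic_map. field. lra.
Qed.

Lemma cubic_map_numerator_pos (s : R) : 0 <= s < 1 -> 0 < 2 - s ^ 2 - s ^ 3.
Proof. intros Hs. replace (2 - s ^ 2 - s ^ 3) with ((1 - s) * (2 + 2 * s + s ^ 2)) by ring. nra. Qed.

Lemma cubic_map_range (s : R) : 0 < s < 1 -> -1 < cubic_map s < 1.
Proof.
intros Hs.
pose proof (cubic_map_denominator_pos s ltac:(lra)) as HD.
pose proof (cubic_map_numerator_pos s ltac:(lra)) as HN.
assert (H1 : 0 < 1 + cubic_map s).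
{ rewrite one_plus_cubic_map by lra. apply Rdiv_lt_0_compat; [|exact HD].
  assert (0 < s ^ 3) by (apply pow_lt; lra). lra. }
assert (H2 : 0 < 1 - cubic_map s).
{ rewrite one_minus_cubic_map by lra. apply Rdiv_lt_0_compat; lra. }
lra.
Qed.

Lemma is_derive_cubic_map (s : R) : 0 <= s <= 1 ->
  is_derive cubic_map s (4 * s ^ 2 * (6 - s ^ 2) / (s ^ 3 - s ^ 2 + 2) ^ 2).
Proof.
intros Hs. pose proof (cubic_map_denominator_pos s Hs) as HD.
unfold cubic_map. auto_derive.
- simpl in HD. lra.
- field. simpl in *; lra.
Qed.

(** The integrand of J. *)
Definition twisted_weight (s : R) : R :=
  (6 - s ^ 2) * weight s * Rpower (1 + s ^ 4 / 4) (- (2 / 3)).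

Lemma is_derive_twisted_primitive (c : R) : -1 < c < 1 ->
  is_derive (primitive twisted_weight) c (twisted_weight c).
Proof.
apply is_derive_primitive. intros x Hx.
unfold twisted_weight, weight, Rpower. auto_derive.
repeat split; nra.
Qed.

(** The substitution works because 1 - y^2 is, up to the cube of r = 2s / (s^3 - s^2 + 2), the
    product (1 - s^2) (4 + s^4) = (2 - s^2 - s^3) (2 - s^2 + s^3); the power -2/3 turns r^3 into
    r^(-2), which cancels the denominator of dy/ds. *)
Lemma weight_cubic_map (s : R) : 0 < s < 1 ->
  Rpower 4 (2 / 3) *
    (4 * s ^ 2 * (6 - s ^ 2) / (s ^ 3 - s ^ 2 + 2) ^ 2 * weight (cubic_map s))
  = twisted_weight s.
Proof.
intros Hs.
pose proof (cubic_map_denominator_pos s ltac:(lra)) as HD.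
pose proof (cubic_map_numerator_pos s ltac:(lra)) as HN.
set (D := s ^ 3 - s ^ 2 + 2) in *.
set (r := 2 * s / D).
assert (Hr : 0 < r) by (apply Rdiv_lt_0_compat; lra).
assert (Hq : 0 < 1 + s ^ 4 / 4).
{ assert (0 <= s ^ 4) by (apply pow_le; lra). lra. }
assert (Hw : 1 - s ^ 2 > 0) by nra.
assert (E : 1 - cubic_map s ^ 2 = 4 * ((1 - s ^ 2) * (1 + s ^ 4 / 4)) * r ^ 3).
{ replace (1 - cubic_map s ^ 2) with ((1 + cubic_map s) * (1 - cubic_map s)) by ring.
  rewrite one_plus_cubic_map, one_minus_cubic_map by lra. fold D.
  replace (4 * ((1 - s ^ 2) * (1 + s ^ 4 / 4))) with ((2 - s ^ 2 - s ^ 3) * D)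
    by (unfold D; field).
  unfold r. field. lra. }
unfold weight at 1. rewrite E.
rewrite <- !Rpower_mult_distr; try lra; try (apply pow_lt; lra);
  try (repeat apply Rmult_lt_0_compat; lra).
assert (E3 : Rpower (r ^ 3) (- (2 / 3)) = / r ^ 2).
{ rewrite <- Rpower_pow by exact Hr. rewrite Rpower_mult.
  replace (INR 3 * - (2 / 3)) with (- INR 2) by (simpl; field).
  rewrite Rpower_Ropp, Rpower_pow by exact Hr. reflexivity. }
rewrite E3. unfold twisted_weight, weight. rewrite (Rpower_Ropp 4).
assert (0 < Rpower 4 (2 / 3)) by apply exp_pos.
unfold r. field. lra.
Qed.

(** The condition u < 1 is needed for the limit of [moment 0], which is one-sided. *)
Lemma filterlim_moment_0_comp (u : R -> R) (F : (R -> Prop) -> Prop) {FF : Filter F} (l : R) :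
  filterlim (moment 0) (at_left 1) (locally l) ->
  filterlim u F (locally 1) -> F (fun x => u x < 1) ->
  filterlim (fun x => moment 0 (u x)) F (locally l).
Proof.
intros Hl Hu Hlt.
apply (filterlim_comp _ _ _ u (moment 0) F (at_left 1)); [|exact Hl].
intros P HP. unfold filtermap.
apply (filter_imp (fun x => (u x < 1 -> P (u x)) /\ u x < 1)).
- intros x [H1 H2]. exact (H1 H2).
- apply filter_and; [exact (Hu _ HP) | exact Hlt].
Qed.

(** 4^(2/3) (moment 0) (y(s)) and the primitive of [twisted_weight] differ by a constant on
    (0,1).  As s tends to 0, y(s) tends to -1, so the constant is -4^(2/3) l by oddness; as s
    tends to 1, y(s) tends to 1, which gives the limit. *)
Lemma twisted_limit (l : R) :
  filterlim (moment 0) (at_left 1) (locally l) ->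
  filterlim (primitive twisted_weight) (at_left 1) (locally (2 * Rpower 4 (2 / 3) * l)).
Proof.
intros Hl.
set (k := Rpower 4 (2 / 3)).
set (H := fun s => k * moment 0 (cubic_map s) + (-1) * primitive twisted_weight s).
assert (Hconst : forall s t, 0 < s <= t -> t < 1 -> H t = H s).
{ intros s t Hs Ht.
  apply derivative_zero_constant; [lra|].
  - intros x Hx. unfold H.
    replace 0 with (k * scal (4 * x ^ 2 * (6 - x ^ 2) / (x ^ 3 - x ^ 2 + 2) ^ 2)
        (weight (cubic_map x)) + (-1) * twisted_weight x).
    + apply (is_derive_plus (V := R_NormedModule) (fun s => k * moment 0 (cubic_map s))
        (fun s => (-1) * primitive twisted_weight s)).
      * apply is_derive_scal.
        apply (is_derive_comp (V := R_NormedModule) (moment 0) cubic_map).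
        -- apply is_derive_moment_0, cubic_map_range. lra.
        -- apply is_derive_cubic_map. lra.
      * apply is_derive_scal, is_derive_twisted_primitive. lra.
    + unfold scal; simpl; unfold mult; simpl.
      rewrite <- weight_cubic_map by lra. unfold k. simpl. ring. }
(* The summands 0 * 0 bring a multiple of one function into the form of [filterlim_linear]. *)
assert (Hright : filterlim H (at_right 0) (locally (k * ((-1) * l + 0 * 0) + (-1) * 0))).
{ apply filterlim_linear; [apply within_filter, locally_filter | |].
  - apply (filterlim_ext_loc (fun s => (-1) * moment 0 (- cubic_map s) + 0 * 0)).
    + apply (locally_interval _ 0 m_infty 1); simpl; try lra; try exact I.
      intros s _ Hs1 Hs0. rewrite moment_0_odd by (apply cubic_map_range; lra). ring.
    + apply filterlim_linear; [apply within_filter, locally_filter | |apply filterlim_const].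
      apply filterlim_moment_0_comp; [apply within_filter, locally_filter | exact Hl | |].
      * replace 1 with (- cubic_map 0) by (unfold cubic_map; field).
        apply (filterlim_filter_le_1 (G := at_right 0) (F := locally 0)).
        -- apply filter_le_within.
        -- apply (ex_derive_continuous (V := R_NormedModule) (fun s => - cubic_map s)).
           apply (ex_derive_opp (V := R_NormedModule) cubic_map).
           eexists. apply is_derive_cubic_map. lra.
      * apply (locally_interval _ 0 m_infty 1); simpl; try lra; try exact I.
        intros s _ Hs1 Hs0. pose proof (cubic_map_range s). lra.
  - apply (filterlim_filter_le_1 (G := at_right 0) (F := locally 0)).
    + apply filter_le_within.
    + replace 0 with (primitive twisted_weight 0) at 2
        by apply (RInt_point (V := R_CompleteNormedModule)).
      apply (ex_derive_continuous (V := R_NormedModule) (primitive twisted_weight)).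
      eexists. apply is_derive_twisted_primitive. lra. }
assert (Hval : forall s, 0 < s < 1 -> H s = - k * l).
{ intros s Hs.
  apply (filterlim_locally_unique (F := at_right 0) H).
  - apply (filterlim_ext_loc (fun _ => H s)).
    + apply (locally_interval _ 0 m_infty s); simpl; try lra; try exact I.
      intros t _ Ht1 Ht0. apply Hconst; lra.
    + apply filterlim_const.
  - replace (- k * l) with (k * ((-1) * l + 0 * 0) + (-1) * 0) by ring. exact Hright. }
apply (filterlim_ext_loc (fun s => k * moment 0 (cubic_map s) + 1 * (k * l))).
- apply (at_left_eventually 0); [lra|]. intros s Hs. pose proof (Hval s Hs) as E.
  unfold H in E. lra.
- replace (2 * k * l) with (k * l + 1 * (k * l)) by ring.
  apply filterlim_linear; [apply within_filter, locally_filter | |apply filterlim_const].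
  apply filterlim_moment_0_comp; [apply within_filter, locally_filter | exact Hl | |].
  + apply (filterlim_filter_le_1 (G := at_left 1) (F := locally 1)).
    * apply filter_le_within.
    * replace 1 with (cubic_map 1) at 2 by (unfold cubic_map; field).
      apply (ex_derive_continuous (V := R_NormedModule) cubic_map).
      eexists. apply is_derive_cubic_map. lra.
  + apply (at_left_eventually 0); [lra|]. intros s Hs. pose proof (cubic_map_range s). lra.
Qed.

(** * Termwise integration *)

(** J over (0,c), with (1 + s^4/4)^(-2/3) replaced by its N-th partial sum. *)
Definition moment_sum (N : nat) (c : R) : R :=
  sum_n (fun j => binomial_coefficient (2 / 3) j * (- (1 / 4)) ^ j
    * (6 * moment (2 * j) c - moment (2 * j + 1) c)) N.

Lemma is_derive_moment_sum (N : nat) (c : R) : -1 < c < 1 ->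
  is_derive (moment_sum N) c
    ((6 - c ^ 2) * weight c * binomial_sum (2 / 3) (c ^ 4 / 4) N).
Proof.
intros Hc.
replace ((6 - c ^ 2) * weight c * binomial_sum (2 / 3) (c ^ 4 / 4) N) with
  (sum_n (fun j => binomial_coefficient (2 / 3) j * (- (1 / 4)) ^ j
    * (6 * (c ^ (2 * (2 * j)) * weight c) - c ^ (2 * (2 * j + 1)) * weight c)) N).
- apply (is_derive_sum_n (V := R_NormedModule)
    (fun j c => binomial_coefficient (2 / 3) j * (- (1 / 4)) ^ j
    * (6 * moment (2 * j) c - moment (2 * j + 1) c))).
  intros j _. apply is_derive_scal.
  apply (is_derive_minus (V := R_NormedModule) (fun c => 6 * moment (2 * j) c)
    (moment (2 * j + 1))).
  + apply is_derive_scal. now apply is_derive_moment.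
  + now apply is_derive_moment.
- unfold binomial_sum. rewrite <- (sum_n_mult_l (K := R_Ring)).
  apply sum_n_ext. intros j. unfold mult; simpl.
  replace (- (c * (c * (c * (c * 1))) / 4)) with (- (1 / 4) * c ^ 4) by (simpl; field).
  rewrite Rpow_mult_distr, <- pow_mult.
  replace (j + (j + 0) + (j + (j + 0) + 0))%nat with (4 * j)%nat by lia.
  replace (j + (j + 0) + 1 + (j + (j + 0) + 1 + 0))%nat with (4 * j + 2)%nat by lia.
  rewrite pow_add. ring.
Qed.

Lemma moment_sum_error (N : nat) (c : R) : 0 <= c < 1 ->
  Rabs (moment_sum N c - primitive twisted_weight c) <= 6 * (1 / 2) ^ S N * moment 0 c.
Proof.
intros Hc.
assert (H0 : moment_sum N 0 = 0).
{ unfold moment_sum. induction N as [|N IH].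
  - rewrite sum_O, !moment_at_0. ring.
  - rewrite sum_Sn, IH, !moment_at_0. unfold plus; simpl. ring. }
assert (H1 : primitive twisted_weight 0 = 0) by apply (RInt_point (V := R_CompleteNormedModule)).
assert (H : Rabs (moment_sum N c - primitive twisted_weight c
    - (moment_sum N 0 - primitive twisted_weight 0))
  <= 6 * (1 / 2) ^ S N * moment 0 c - 6 * (1 / 2) ^ S N * moment 0 0).
{ apply (derivative_dominates (fun c => moment_sum N c - primitive twisted_weight c)
    (fun x => (6 - x ^ 2) * weight x * binomial_sum (2 / 3) (x ^ 4 / 4) N - twisted_weight x)
    (fun c => 6 * (1 / 2) ^ S N * moment 0 c)
    (fun x => 6 * (1 / 2) ^ S N * weight x)); try lra.
  - intros x Hx. apply (is_derive_minus (V := R_NormedModule) (moment_sum N)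
      (primitive twisted_weight)).
    + apply is_derive_moment_sum; lra.
    + apply is_derive_twisted_primitive; lra.
  - intros x Hx. apply is_derive_scal, is_derive_moment_0; lra.
  - intros x Hx. unfold twisted_weight.
    rewrite <- Rmult_minus_distr_l, !Rabs_mult.
    pose proof (weight_pos x).
    assert (Hx4 : 0 <= x ^ 4 <= 1).
    { split; [apply pow_le; lra|]. rewrite <- (pow1 4). apply pow_incr; lra. }
    assert (He := binomial_sum_error (2 / 3) (x ^ 4 / 4) N ltac:(lra) ltac:(lra)).
    rewrite (Rabs_pos_eq (6 - x ^ 2)), (Rabs_pos_eq (weight x)) by nra.
    replace (6 * (1 / 2) ^ S N * weight x) with (6 * weight x * (1 / 2) ^ S N) by ring.
    apply Rmult_le_compat; [nra | apply Rabs_pos | nra | exact He]. }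
rewrite H0, H1, moment_at_0 in H.
replace (moment_sum N c - primitive twisted_weight c)
  with (moment_sum N c - primitive twisted_weight c - (0 - 0)) by ring.
lra.
Qed.

(** The moments of the weight divided by its total mass. *)
Definition moment_ratio (n : nat) : R :=
  rising_factorial (1 / 2) n / rising_factorial (5 / 6) n.

Definition ratio_sum (N : nat) : R :=
  sum_n (fun j => binomial_coefficient (2 / 3) j * (- (1 / 4)) ^ j
    * (6 * moment_ratio (2 * j) - moment_ratio (2 * j + 1))) N.

Lemma moment_sum_limit (l : R) (N : nat) :
  filterlim (moment 0) (at_left 1) (locally l) ->
  filterlim (moment_sum N) (at_left 1) (locally (l * ratio_sum N)).
Proof.
intros Hl.
assert (Hterm : forall j, filterlim (fun c => binomial_coefficient (2 / 3) j * (- (1 / 4)) ^ j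
    * (6 * moment (2 * j) c - moment (2 * j + 1) c)) (at_left 1)
  (locally (l * (binomial_coefficient (2 / 3) j * (- (1 / 4)) ^ j
    * (6 * moment_ratio (2 * j) - moment_ratio (2 * j + 1)))))).
{ intros j. set (b := binomial_coefficient (2 / 3) j * (- (1 / 4)) ^ j).
  apply (filterlim_ext (fun c => (b * 6) * moment (2 * j) c + (- b) * moment (2 * j + 1) c)).
  - intros c. ring.
  - replace (l * (b * (6 * moment_ratio (2 * j) - moment_ratio (2 * j + 1))))
      with ((b * 6) * (l * moment_ratio (2 * j)) + (- b) * (l * moment_ratio (2 * j + 1)))
      by ring.
    apply filterlim_linear; [apply within_filter, locally_filter | |];
      now apply moment_limit. }
induction N as [|N IH].
- apply (filterlim_ext (fun c => binomial_coefficient (2 / 3) 0 * (- (1 / 4)) ^ 0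
    * (6 * moment (2 * 0) c - moment (2 * 0 + 1) c))).
  + intros c. unfold moment_sum. now rewrite sum_O.
  + unfold ratio_sum. rewrite sum_O. apply Hterm.
- apply (filterlim_ext (fun c => 1 * moment_sum N c + 1 * (binomial_coefficient (2 / 3) (S N)
    * (- (1 / 4)) ^ S N * (6 * moment (2 * S N) c - moment (2 * S N + 1) c)))).
  + intros c. unfold moment_sum. rewrite sum_Sn, !Rmult_1_l. reflexivity.
  + unfold ratio_sum. rewrite sum_Sn. fold (ratio_sum N).
    match goal with |- filterlim _ _ (locally (l * plus _ ?t)) =>
      change (plus (ratio_sum N) t) with (ratio_sum N + t);
      replace (l * (ratio_sum N + t)) with (1 * (l * ratio_sum N) + 1 * (l * t)) by ring end.
    apply filterlim_linear; [apply within_filter, locally_filter | exact IH | apply Hterm].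
Qed.

(** The two evaluations of J compared: l times [ratio_sum N] and 2 * 4^(2/3) l differ by at most
    l times the remainder of the binomial series times max (6 - s^2) = 6. *)
Lemma ratio_sum_error (N : nat) :
  Rabs (ratio_sum N - 2 * Rpower 4 (2 / 3)) <= 6 * (1 / 2) ^ S N.
Proof.
destruct moment_0_limit as [l [Hpos Hl]].
assert (key : forall e, Rabs e <= 1 ->
  0 <= 6 * (1 / 2) ^ S N * l + e * (1 * (l * ratio_sum N) + (-1) * (2 * Rpower 4 (2 / 3) * l))).
{ intros e He.
  apply (filterlim_le (F := at_left 1) (fun _ => 0)
    (fun c => 6 * (1 / 2) ^ S N * moment 0 c
      + e * (1 * moment_sum N c + (-1) * primitive twisted_weight c)) 0
    (6 * (1 / 2) ^ S N * l + e * (1 * (l * ratio_sum N) + (-1) * (2 * Rpower 4 (2 / 3) * l)))).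
  - apply (at_left_eventually 0); [lra|]. intros c Hc.
    pose proof (moment_sum_error N c ltac:(lra)) as H.
    assert (- (e * (moment_sum N c - primitive twisted_weight c))
      <= Rabs (moment_sum N c - primitive twisted_weight c)).
    { apply Rle_trans with (1 := Rle_abs _). rewrite Rabs_Ropp, Rabs_mult.
      pose proof (Rabs_pos (moment_sum N c - primitive twisted_weight c)). nra. }
    lra.
  - apply filterlim_const.
  - apply (filterlim_linear (at_left 1)); [exact Hl|].
    apply (filterlim_linear (at_left 1)); [now apply moment_sum_limit | now apply twisted_limit]. }
assert (H1 := key 1 ltac:(rewrite Rabs_R1; lra)).
assert (H2 := key (-1) ltac:(rewrite Rabs_left; lra)).
apply Rabs_le. split; apply (Rmult_le_reg_l l); lra.
Qed.

(** * Reduction of the given series to the integrated one *)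

Lemma rising_factorial_shift (x : R) (j : nat) :
  x * rising_factorial (x + 1) j = rising_factorial x j * (x + INR j).
Proof.
induction j as [|j IH]; [simpl; ring|].
rewrite S_INR. simpl. rewrite <- Rmult_assoc, IH. ring.
Qed.

Lemma rising_factorial_double (x : R) (j : nat) :
  rising_factorial (2 * x) (2 * j)
  = 4 ^ j * (rising_factorial x j * rising_factorial (x + 1 / 2) j).
Proof.
induction j as [|j IH]; [simpl; ring|].
replace (2 * S j)%nat with (S (S (2 * j))) by lia.
cbn [rising_factorial pow]. rewrite IH, S_INR, mult_INR. simpl (INR 2). field.
Qed.

Definition integrated_coefficient (j : nat) : R :=
  (- (1 / 4)) ^ j * binomial_coefficient (2 / 3) j * moment_ratio (2 * j).

Lemma moment_ratio_double (j : nat) :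
  moment_ratio (2 * j) = rising_factorial (1 / 4) j * rising_factorial (3 / 4) j
    / (rising_factorial (5 / 12) j * rising_factorial (11 / 12) j).
Proof.
unfold moment_ratio.
replace (1 / 2) with (2 * (1 / 4)) by field.
replace (5 / 6) with (2 * (5 / 12)) by field.
rewrite !rising_factorial_double.
replace (1 / 4 + 1 / 2) with (3 / 4) by field.
replace (5 / 12 + 1 / 2) with (11 / 12) by field.
pose proof (rising_factorial_pos (5 / 12) j). pose proof (rising_factorial_pos (11 / 12) j).
assert (0 < 4 ^ j) by (apply pow_lt; lra).
field. lra.
Qed.

Lemma integrated_coefficient_S (j : nat) :
  integrated_coefficient (S j) = integrated_coefficient j * (- (1 / 4) * ((2 / 3 + INR j) * (1 / 4 + INR j) * (3 / 4 + INR j))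
    / ((1 + INR j) * (5 / 12 + INR j) * (11 / 12 + INR j))).
Proof.
unfold integrated_coefficient. rewrite !moment_ratio_double. unfold binomial_coefficient.
cbn [rising_factorial pow].
pose proof (rising_factorial_pos (5 / 12) j). pose proof (rising_factorial_pos (11 / 12) j).
pose proof (rising_factorial_pos 1 j). pose proof (pos_INR j).
field. lra.
Qed.

Definition summand (j : nat) : R :=
  (- (1 / 4)) ^ j
  * ((rising_factorial (2 / 3) j * rising_factorial (3 / 4) j
      * rising_factorial (5 / 4) j)
     / (rising_factorial (5 / 12) j * rising_factorial 1 j
        * rising_factorial (23 / 12) j))
  * (10 * INR j + 9).

Lemma summand_eq_integrated_coefficient (j : nat) :
  summand j = integrated_coefficient j
    * ((1 + 4 * INR j) * (10 * INR j + 9) * (11 / (11 + 12 * INR j))).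
Proof.
pose proof (rising_factorial_shift (1 / 4) j) as E1.
pose proof (rising_factorial_shift (11 / 12) j) as E2.
replace (1 / 4 + 1) with (5 / 4) in E1 by field.
replace (11 / 12 + 1) with (23 / 12) in E2 by field.
pose proof (rising_factorial_pos (5 / 12) j). pose proof (rising_factorial_pos (11 / 12) j).
pose proof (rising_factorial_pos 1 j). pose proof (pos_INR j).
unfold summand, integrated_coefficient. rewrite moment_ratio_double. unfold binomial_coefficient.
replace (rising_factorial (5 / 4) j) with (rising_factorial (1 / 4) j * (1 + 4 * INR j)) by lra.
replace (rising_factorial (23 / 12) j)
  with (rising_factorial (11 / 12) j * (11 + 12 * INR j) / 11) by lra.
field. lra.
Qed.

Lemma ratio_term (j : nat) :
  binomial_coefficient (2 / 3) j * (- (1 / 4)) ^ j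
    * (6 * moment_ratio (2 * j) - moment_ratio (2 * j + 1))
  = integrated_coefficient j * ((20 * INR j + 9) / (4 * INR j + 5 / 3)).
Proof.
unfold integrated_coefficient, moment_ratio. rewrite Nat.add_1_r.
cbn [rising_factorial]. rewrite mult_INR. simpl (INR 2).
pose proof (rising_factorial_pos (5 / 6) (2 * j)). pose proof (pos_INR j).
field. lra.
Qed.

(** Both summands are rational multiples of t_j, and their combination is summable in closed form
    with certificate a multiple of j t_j, as Gosper's algorithm finds.  The factor 11/9 is the
    quotient of the two sums, and 88/3 is fixed by the terms of index 0:
    9 - 11/9 * 27/5 = 12/5, while t_1 = -9/110. *)
Lemma summand_telescopes (N : nat) :
  sum_n summand N = 11 / 9 * ratio_sum N - 88 / 3 * (INR (S N) * integrated_coefficient (S N)).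
Proof.
assert (step : forall j, summand j
  = 11 / 9 * (integrated_coefficient j * ((20 * INR j + 9) / (4 * INR j + 5 / 3)))
    - 88 / 3 * (INR (S j) * integrated_coefficient (S j)) + 88 / 3 * (INR j * integrated_coefficient j)).
{ intros j. rewrite summand_eq_integrated_coefficient, integrated_coefficient_S, S_INR. pose proof (pos_INR j).
  field. lra. }
unfold ratio_sum. induction N as [|N IH].
- rewrite !sum_O, ratio_term, (step 0%nat). simpl (INR 0).
  match goal with |- ?a = ?b => change (@eq R a b) end. ring.
- rewrite !sum_Sn, IH, ratio_term, (step (S N)).
  match goal with |- plus ?a ?b = _ * plus ?c ?d - ?e =>
    change (@eq R (a + b) (11 / 9 * (c + d) - e)) end.
  ring.
Qed.

Lemma integrated_coefficient_bound (j : nat) : Rabs (integrated_coefficient j) <= (1 / 4) ^ j.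
Proof.
induction j as [|j IH].
- unfold integrated_coefficient, binomial_coefficient, moment_ratio; simpl. rewrite Rabs_pos_eq; lra.
- rewrite integrated_coefficient_S, Rabs_mult. pose proof (pos_INR j).
  replace ((1 / 4) ^ S j) with ((1 / 4) ^ j * (1 / 4)) by (simpl; ring).
  apply Rmult_le_compat; try apply Rabs_pos; [exact IH|].
  set (n := INR j) in *.
  replace (- (1 / 4) * ((2 / 3 + n) * (1 / 4 + n) * (3 / 4 + n))
      / ((1 + n) * (5 / 12 + n) * (11 / 12 + n)))
    with (- (1 / 4 * (((2 / 3 + n) / (1 + n)) * (((1 / 4 + n) / (5 / 12 + n))
       * ((3 / 4 + n) / (11 / 12 + n)))))) by (field; lra).
  assert (frac : forall p q, 0 < p <= q -> 0 <= (p + n) / (q + n) <= 1).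
  { intros p q Hpq. split.
    - apply Rlt_le, Rdiv_lt_0_compat; lra.
    - apply (Rmult_le_reg_r (q + n)); [lra|]. unfold Rdiv.
      rewrite Rmult_assoc, Rinv_l; lra. }
  pose proof (frac (2 / 3) 1 ltac:(lra)). pose proof (frac (1 / 4) (5 / 12) ltac:(lra)).
  pose proof (frac (3 / 4) (11 / 12) ltac:(lra)).
  rewrite Rabs_Ropp.
  assert (0 <= (1 / 4 + n) / (5 / 12 + n) * ((3 / 4 + n) / (11 / 12 + n)) <= 1) by nra.
  rewrite Rabs_pos_eq; nra.
Qed.

Lemma Rpower_4_2_3 : Rpower 4 (2 / 3) = 2 * Rpower 2 (1 / 3).
Proof.
replace 4 with (2 ^ 2) by ring.
rewrite <- Rpower_pow by lra. rewrite Rpower_mult.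
replace (2 * Rpower 2 (1 / 3)) with (Rpower 2 1 * Rpower 2 (1 / 3))
  by (rewrite Rpower_1; lra).
rewrite <- Rpower_plus. f_equal. simpl. field.
Qed.

Lemma summand_error (N : nat) :
  Rabs (sum_n summand N - 44 * Rpower 2 (1 / 3) / 9) <= 40 * (1 / 2) ^ S N.
Proof.
assert (H1 := ratio_sum_error N).
rewrite Rpower_4_2_3 in H1.
assert (H2 : Rabs (INR (S N) * integrated_coefficient (S N)) <= (1 / 2) ^ S N).
{ rewrite Rabs_mult, Rabs_pos_eq by apply pos_INR.
  replace ((1 / 2) ^ S N) with (2 ^ S N * (1 / 4) ^ S N)
    by (rewrite <- Rpow_mult_distr; f_equal; field).
  apply Rmult_le_compat; [apply pos_INR | apply Rabs_pos | apply INR_le_pow2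
    | apply integrated_coefficient_bound]. }
rewrite summand_telescopes.
apply Rabs_le_between in H1. apply Rabs_le_between in H2. apply Rabs_le.
lra.
Qed.

Theorem mainTheorem15 :
  is_series
    (fun j : nat =>
       (- (1 / 4)) ^ j
       * ((rising_factorial (2 / 3) j * rising_factorial (3 / 4) j
           * rising_factorial (5 / 4) j)
          / (rising_factorial (5 / 12) j * rising_factorial 1 j
             * rising_factorial (23 / 12) j))
       * (10 * INR j + 9))
    (44 * Rpower 2 (1 / 3) / 9).
Proof.
change (is_lim_seq (sum_n summand) (44 * Rpower 2 (1 / 3) / 9)).
assert (Hgeom : forall e, is_lim_seq (fun N => 44 * Rpower 2 (1 / 3) / 9 + e * (1 / 2) ^ S N)
  (44 * Rpower 2 (1 / 3) / 9)).
{ intros e. set (v := 44 * Rpower 2 (1 / 3) / 9).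
  assert (H : is_lim_seq (fun N => v + e * (1 / 2) ^ S N) (v + e * 0)).
  { apply is_lim_seq_plus'; [apply is_lim_seq_const|].
    apply (is_lim_seq_scal_l (fun N => (1 / 2) ^ S N) e 0).
    apply (is_lim_seq_incr_1 (fun N => (1 / 2) ^ N)).
    apply is_lim_seq_geom. rewrite Rabs_pos_eq; lra. }
  rewrite Rmult_0_r, Rplus_0_r in H. exact H. }
apply (is_lim_seq_le_le
  (fun N => 44 * Rpower 2 (1 / 3) / 9 + - 40 * (1 / 2) ^ S N) (sum_n summand)
  (fun N => 44 * Rpower 2 (1 / 3) / 9 + 40 * (1 / 2) ^ S N)); try apply Hgeom.
intros N. pose proof (summand_error N) as H. apply Rabs_le_between in H. lra.
Qed.
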